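(* Let $m>0$ and $n\ge 0$ be integers. The parameterized family of games generalized-matching-pennies-with-duds with these $m,n$ (where the set $D$ of duds is unknown to player 1) is BL-WoLF-learnable with loss $n$.
   Context: Stage game. There are two players, player 1 (the learner) and player 2 (the opponent), with finite action sets $A_1, A_2$. Each pair of actions determines a pair of utilities; the game is zero-sum (the utilities sum to a constant). A stage-game strategy for player $i$ is a probability distribution over $A_i$. The value $V$ of the game is $V=\max_{\sigma_1}\min_{\sigma_2}E[u_1\mid\sigma_1,\sigma_2]$. Repeated game. A parameterized family of stage games consists of fixed action sets $A_1,A_2$, a parameter set $K$, and a map sending each $k\in K$ to a zero-sum stage game with these action sets. One $k \in K$ is fixed, and the corresponding stage game is played over and over. Player 2 knows $k$ and player 1's learning strategy; player 1 knows only the family. After each round player 1 observes both actions and the payoffs. A learning strategy for player 1 prescribes a stage-game strategy for each history of past actions and payoffs; the opponent may likewise use any history-dependent strategy. Player 1's loss in a round is $V$ (the value of the actual stage game) minus the utility player 1 received in that round; the loss incurred over several rounds is the sum of the losses of those rounds. BL-WoLF-learnability. A family is BL-WoLF-learnable with loss $l$ if there exists a learning strategy for player 1 such that, for any game in the family, against any opponent, and for any integer $N\ge 0$, player 1's expected cumulative loss over the first $N$ rounds is at most $l$. The family generalized-matching-pennies-with-duds. For given $m>0$ and $n$ (known to both players), both players have action set $A=\{1,2,\ldots,m+n\}$. The outcome is determined by a subset $D\subseteq A$ with $|D|=n$ (the unknown parameter), whose elements are called duds. Given the players' actions: if one player plays a dud and the other does not, the latter wins. Otherwise, if both players play the same action,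 player 2 wins; and if they play different actions, player 1 wins. The winner gets utility $1$, the loser $0$. Player 1 initially does not know $D$. *)

(* Defs.v *)
From HB Require Import structures.
From mathcomp Require Import all_boot all_order all_algebra.
From mathcomp Require Import boolp classical_sets reals.

Set Implicit Arguments.
Unset Strict Implicit.
Unset Printing Implicit Defensive.

Import Order.TTheory GRing.Theory Num.Theory.
Local Open Scope ring_scope.
Local Open Scope classical_set_scope.

Record dist (R : realType) (A : finType) := Dist {
  pmf :> {ffun A -> R};
  pmf_ge0 : forall a, 0 <= pmf a;
  pmf_sum1 : \sum_a pmf a = 1 }.

Record zs_game (R : realType) (A1 A2 : finType) := ZSGame {
  util1 : A1 -> A2 -> R;
  util2 : A1 -> A2 -> R;
  util_const_sum : exists c, forall a b, util1 a b + util2 a b = c }.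

Section ZeroSumGames.
Variables (R : realType) (A1 A2 : finType).

Definition expected_util1 (G : zs_game R A1 A2)
    (s1 : dist R A1) (s2 : dist R A2) : R :=
  \sum_a \sum_b s1 a * s2 b * util1 G a b.

(* The maximin value.  The action sets being finite, both extrema are attained
   (when the action sets are nonempty), so inf and sup are a min and a max. *)
Definition value (G : zs_game R A1 A2) : R :=
  sup [set inf [set expected_util1 G s1 s2 | s2 in [set: dist R A2]]
      | s1 in [set: dist R A1]].

(* What is observed in one round: the two actions, then the two payoffs. *)
Definition observation : Type := (A1 * A2) * (R * R).

(* Histories list the rounds in chronological order. *)
Definition strategy (A : finType) : Type := seq observation -> dist R A.

Definition history (G : zs_game R A1 A2) (s : seq (A1 * A2)) :
    seq observation :=
  [seq (ab, (util1 G ab.1 ab.2, util2 G ab.1 ab.2)) | ab <- s].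

(* Probability of a sequence of action pairs; within a round, the two players
   randomize independently given the common history. *)
Definition play_prob (G : zs_game R A1 A2) (L : strategy A1) (O : strategy A2)
    (N : nat) (p : N.-tuple (A1 * A2)) : R :=
  \prod_(t < N) (L (history G (take t p)) (tnth p t).1 *
                 O (history G (take t p)) (tnth p t).2).

Definition round_loss (G : zs_game R A1 A2) (ab : A1 * A2) : R :=
  value G - util1 G ab.1 ab.2.

Definition expected_loss (G : zs_game R A1 A2)
    (L : strategy A1) (O : strategy A2) (N : nat) : R :=
  \sum_(p : N.-tuple (A1 * A2))
    play_prob G L O p * \sum_(t < N) round_loss G (tnth p t).

(* The opponent O is quantified after both the learning strategy L and the
   parameter k, hence may depend on them. *)
Definition BL_WoLF_learnable (K : Type) (F : K -> zs_game R A1 A2) (l : R) :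
    Prop :=
  exists L : strategy A1, forall (k : K) (O : strategy A2) (N : nat),
    expected_loss (F k) L O N <= l.

End ZeroSumGames.

Section MatchingPenniesWithDuds.
Variables (R : realType) (m n : nat).

Definition dud_set : Type := {D : {set 'I_(m + n)} | #|D| == n}.

Definition player1_wins (D : {set 'I_(m + n)}) (a b : 'I_(m + n)) : bool :=
  if (a \in D) != (b \in D) then b \in D else a != b.

Lemma win_const_sum (D : {set 'I_(m + n)}) :
  exists c : R, forall a b : 'I_(m + n),
    (player1_wins D a b)%:R + (~~ player1_wins D a b)%:R = c.
Proof.
by exists 1 => a b; case: player1_wins; rewrite ?addr0 ?add0r.
Qed.

Definition matching_pennies_with_duds (D : dud_set) :
    zs_game R 'I_(m + n) 'I_(m + n) :=
  ZSGame (win_const_sum (val D)).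

End MatchingPenniesWithDuds.

(* Main.v *)
Require Import Defs.
From mathcomp Require Import all_boot all_order all_algebra.
From mathcomp Require Import reals.
From mathcomp Require Import ring.
From mathcomp Require boolp classical_sets.

(** Player 1 mixes uniformly over the set S of actions not yet revealed as duds,
    where a is revealed when it loses against some b != a.  Since the winner of
    (a, b) is player 1, or a is revealed, exactly when a != b, each round gives
    P(win) + P(an element of S is revealed) >= 1 - 1/#|S| >= 1 - 1/m.  The value
    of the game is at most 1 - 1/m, so the expected loss of a round is at most
    the expected decrease of #|S| - m, which starts at n and stays
    nonnegative. *)

Set Implicit Arguments.
Unset Strict Implicit.
Unset Printing Implicit Defensive.

Import Order.TTheory GRing.Theory Num.Theory.
Local Open Scope ring_scope.

Section Uniform.
Variables (R : realType) (A : finType) (S : {set A}).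
Hypothesis S_gt0 : (0 < #|S|)%N.

Let uniform_pmf : {ffun A -> R} := [ffun a => (a \in S)%:R / #|S|%:R].

Let uniform_ge0 a : 0 <= uniform_pmf a.
Proof. by rewrite ffunE divr_ge0 ?ler0n. Qed.

Let uniform_sum1 : \sum_a uniform_pmf a = 1.
Proof.
under eq_bigr do rewrite ffunE mulrb.
by rewrite -mulr_suml -big_mkcond sumr_const divff // pnatr_eq0 -lt0n.
Qed.

Definition uniform : dist R A := Dist uniform_ge0 uniform_sum1.

Lemma uniform_expectation (f : A -> R) :
  \sum_a uniform a * f a = (\sum_(a in S) f a) / #|S|%:R.
Proof.
rewrite mulr_suml [RHS]big_mkcond /=; apply: eq_bigr => a _.
by rewrite ffunE; case: (a \in S); rewrite ?mul0r // mul1r mulrC.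
Qed.

End Uniform.

Lemma dist_sum_le (R : realType) (A : finType) (s : dist R A) (f : A -> R) c :
  (forall a, f a <= c) -> \sum_a s a * f a <= c.
Proof.
move=> fc; rewrite -[leRHS]mul1r -(pmf_sum1 s) mulr_suml.
by apply: ler_sum => a _; rewrite ler_wpM2l ?pmf_ge0.
Qed.

Lemma big_tuple_rcons (V : nmodType) (T : finType) N
    (F : N.+1.-tuple T -> V) :
  \sum_p F p = \sum_(p : N.-tuple T) \sum_x F [tuple of rcons p x].
Proof.
rewrite pair_big /=.
rewrite (reindex (fun q : N.-tuple T * T => [tuple of rcons q.1 q.2])) //=.
apply/onW_bij/inj_card_bij => [[p x] [q y] /(congr1 val)/rcons_inj [pq ->]|].
  by congr pair; apply: val_inj.
by rewrite card_prod !card_tuple expnS mulnC.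
Qed.

Section ZeroSum.
Variables (R : realType) (A1 A2 : finType) (G : zs_game R A1 A2).

Lemma value_le (s2 : dist R A2) (c : R) :
    (forall a b, 0 <= util1 G a b) -> 0 <= c ->
  (forall a, \sum_b s2 b * util1 G a b <= c) -> value G <= c.
Proof.
move=> u_ge0 c_ge0 s2c; rewrite /value; set E := (X in sup X).
case: (boolp.pselect (classical_sets.has_sup E)) => [[E0 _]|/sup_out -> //].
apply: ge_sup => // _ [s1 _ <-].
apply: (@le_trans _ _ (expected_util1 G s1 s2)).
  apply: ge_inf; last by exists s2.
  exists 0 => _ [s _ <-]; apply: sumr_ge0 => a _; apply: sumr_ge0 => b _.
  by rewrite !mulr_ge0 ?pmf_ge0.
rewrite /expected_util1; under eq_bigr => a _.
  under eq_bigr => b _ do rewrite -mulrA.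
  rewrite -mulr_sumr; over.
exact: dist_sum_le.
Qed.

Variables (L : strategy R A1 A2 A1) (O : strategy R A1 A2 A2).

Lemma play_prob_rcons N (p : N.-tuple (A1 * A2)) ab :
  play_prob G L O [tuple of rcons p ab] =
  play_prob G L O p * (L (history G p) ab.1 * O (history G p) ab.2).
Proof.
rewrite /play_prob big_ord_recr /=; congr (_ * _); last first.
  by rewrite (tnth_nth ab) /= -cats1 takel_cat ?size_tuple // take_oversize
     ?size_tuple // nth_cat size_tuple ltnn subnn.
apply: eq_bigr => t _; rewrite !(tnth_nth ab) /= nth_rcons size_tuple ltn_ord.
by rewrite -cats1 takel_cat // size_tuple ltnW.
Qed.

Lemma sum_tnth_rcons N (p : N.-tuple (A1 * A2)) ab (f : A1 * A2 -> R) :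
  \sum_(t < N.+1) f (tnth [tuple of rcons p ab] t) =
  \sum_(t < N) f (tnth p t) + f ab.
Proof.
by rewrite -!(big_tuple _ _ _ predT) /= -cats1 big_cat big_seq1.
Qed.

Lemma play_prob_ge0 N (p : N.-tuple (A1 * A2)) : 0 <= play_prob G L O p.
Proof. by apply: prodr_ge0 => t _; rewrite mulr_ge0 ?pmf_ge0. Qed.

Lemma expected_loss_potential (Phi : seq (A1 * A2) -> R) N :
    (forall p, 0 <= Phi p) ->
    (forall p b, \sum_a L (history G p) a *
                   (round_loss G (a, b) + Phi (rcons p (a, b))) <= Phi p) ->
  expected_loss G L O N <= Phi [::].
Proof.
move=> Phi_ge0 Phi_step.
have {}Phi_step p : \sum_ab L (history G p) ab.1 * O (history G p) ab.2 *
    (round_loss G ab + Phi (rcons p ab)) <= Phi p.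
  rewrite (eq_bigr (fun ab => O (history G p) ab.2 * (L (history G p) ab.1 *
      (round_loss G (ab.1, ab.2) + Phi (rcons p (ab.1, ab.2)))))); last first.
    by move=> [a b] _; rewrite mulrA [in RHS](mulrC (O _ _)).
  rewrite -(pair_bigA _ (fun a b => O (history G p) b * (L (history G p) a *
      (round_loss G (a, b) + Phi (rcons p (a, b)))))) exchange_big /=.
  under eq_bigr do rewrite -mulr_sumr.
  exact: dist_sum_le.
suff: \sum_(p : N.-tuple (A1 * A2)) play_prob G L O p *
        (\sum_(t < N) round_loss G (tnth p t) + Phi p) <= Phi [::].
  apply: le_trans; apply: ler_sum => p _.
  by rewrite ler_wpM2l ?play_prob_ge0 // lerDl.
elim: N => [|N IHN].
  rewrite (big_pred1 [tuple]) => [|p]; last by apply/esym/eqP/tuple0.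
  by rewrite /play_prob !big_ord0 mul1r add0r.
rewrite big_tuple_rcons; apply: le_trans IHN; apply: ler_sum => p _.
under eq_bigr => ab _.
  rewrite play_prob_rcons (sum_tnth_rcons p ab (round_loss G)) -mulrA -addrA.
  rewrite mulrDr; over.
rewrite -mulr_sumr ler_wpM2l ?play_prob_ge0 // big_split /= lerD //.
rewrite -mulr_suml.
rewrite -(pair_bigA _ (fun a b => L (history G p) a * O (history G p) b)).
under eq_bigr do rewrite -mulr_sumr pmf_sum1 mulr1.
by rewrite pmf_sum1 mul1r.
Qed.

End ZeroSum.

Section MatchingPennies.
Variables (R : realType) (m n : nat).
Hypothesis m_gt0 : (0 < m)%N.

Let A : finType := 'I_(m + n).

Definition revealed (h : seq (observation R A A)) : {set A} :=
  [set a | has (fun o => [&& o.1.1 == a, o.1.2 != a & o.2.1 == 0]) h].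

(* The first branch only serves histories that no game of the family produces;
   it keeps the uniform distribution defined. *)
Definition candidates h : {set A} :=
  if ~: revealed h == set0 then setT else ~: revealed h.

Lemma candidates_gt0 h : (0 < #|candidates h|)%N.
Proof.
rewrite /candidates; have [_|] := eqVneq; last by rewrite card_gt0.
by rewrite cardsT card_ord addn_gt0 m_gt0.
Qed.

Definition learner : strategy R A A A := fun h => uniform R (candidates_gt0 h).

Variable D : dud_set m n.
Let G := matching_pennies_with_duds R D.

Let card_nonduds : #|~: val D| = m.
Proof.
by apply/eqP; rewrite cardsCs setCK card_ord (eqP (valP D)) addnK.
Qed.

Lemma player1_wins_neq a b : player1_wins (val D) a b -> a != b.
Proof. by apply: contraTneq => ->; rewrite /player1_wins !eqxx. Qed.

Lemma value_matching_pennies_le : value G <= 1 - m%:R^-1.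
Proof.
have nonduds_gt0 : (0 < #|~: val D|)%N by rewrite card_nonduds.
have c_ge0 : 0 <= 1 - m%:R^-1 :> R.
  by rewrite subr_ge0 invf_le1 ?ler1n ?ltr0n.
apply: (@value_le _ _ _ _ (uniform R nonduds_gt0)) => // a.
rewrite uniform_expectation card_nonduds ler_pdivrMr ?ltr0n // mulrBl mul1r.
rewrite mulVf ?pnatr_eq0 -?lt0n // /= -natr_sum.
have [aD|aD] := boolP (a \in val D).
  rewrite big1 ?subr_ge0 ?ler1n // => b; rewrite inE => /negPf bD.
  by rewrite /player1_wins aD bD.
have -> : m%:R - 1 = #|~: val D :\ a|%:R :> R.
  rewrite -[X in X%:R - 1 = _]card_nonduds (cardsD1 a) inE aD.
  by rewrite natrD addrAC subrr add0r.
rewrite ler_nat (big_setD1 a) ?inE //= /player1_wins !eqxx /= add0n -sum1_card.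
by apply: leq_sum => b _; apply: leq_b1.
Qed.

Lemma revealed_history_rcons p a b :
  revealed (history G (rcons p (a, b))) =
  if (a != b) && ~~ player1_wins (val D) a b then a |: revealed (history G p)
  else revealed (history G p).
Proof.
apply/setP => x.
rewrite !inE /history map_rcons has_rcons /= eq_sym pnatr_eq0 eqb0.
case: eqVneq => [->|xa] /=.
  by rewrite [b == a]eq_sym; case: ifP => _; rewrite !inE ?eqxx.
by case: ifP => _; rewrite !inE // (negPf xa).
Qed.

Lemma revealed_history_dud p : revealed (history G p) \subset val D.
Proof.
elim/last_ind: p => [|p [a b] IHp].
  by apply/subsetP => a; rewrite inE.
rewrite revealed_history_rcons; case: ifP => // /andP[ab].
rewrite /player1_wins ab subUset IHp sub1set andbT.
by case: (a \in _); case: (b \in _).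
Qed.

Lemma candidates_history p :
  candidates (history G p) = ~: revealed (history G p).
Proof.
rewrite /candidates ifF //; apply/negbTE; rewrite -card_gt0.
apply: leq_trans (subset_leq_card (_ : ~: val D \subset _)).
  by rewrite card_nonduds.
by rewrite setCS revealed_history_dud.
Qed.

Definition potential (p : seq (A * A)) : R :=
  #|candidates (history G p)|%:R - m%:R.

Lemma potential_ge0 p : 0 <= potential p.
Proof.
rewrite subr_ge0 ler_nat candidates_history -[leqLHS]card_nonduds.
by rewrite subset_leq_card // setCS revealed_history_dud.
Qed.

Lemma potential_rcons p a b : a \in candidates (history G p) ->
  potential (rcons p (a, b)) =
  potential p + (player1_wins (val D) a b)%:R - (a != b)%:R.
Proof.
rewrite /potential !candidates_history revealed_history_rcons => aS.
have := @player1_wins_neq a b; case: player1_wins => [->//|_].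
  by rewrite addrK.
rewrite addr0; case: eqVneq => _ /=; first by rewrite subr0.
rewrite setCU setIC -setDE [in RHS](cardsD1 a) aS.
by rewrite natrD addrAC [1 + _]addrC addrK.
Qed.

Lemma potential_step p b :
  \sum_a learner (history G p) a *
    (round_loss G (a, b) + potential (rcons p (a, b))) <= potential p.
Proof.
set S := candidates (history G p).
have S_gt0 : 0 < #|S|%:R :> R by rewrite ltr0n candidates_gt0.
rewrite uniform_expectation ler_pdivrMr //.
rewrite (eq_bigr (fun a => value G + potential p - (a != b)%:R)); last first.
  by move=> a aS; rewrite potential_rcons //= /round_loss /=; ring.
rewrite sumrB sumr_const -[(_ + _) *+ _]mulr_natr mulrDl addrAC gerDr subr_le0.
apply: (@le_trans _ _ ((1 - m%:R^-1) * #|S|%:R)).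
  by rewrite ler_wpM2r ?ler0n // value_matching_pennies_le.
have mS : m%:R <= #|S|%:R :> R by rewrite -subr_ge0 potential_ge0.
apply: (@le_trans _ _ (#|S|%:R - 1)).
  by rewrite mulrBl mul1r lerB // ler_pdivlMl ?ltr0n // mulr1.
rewrite lerBlDr -natr_sum natr1 ler_nat (cardsD1 b) -add1n leq_add ?leq_b1 //.
rewrite -sum1_card [leqLHS]big_mkcond [leqRHS]big_mkcond /=.
by apply: leq_sum => a _; rewrite !inE; case: (a != b); case: (a \in S).
Qed.

End MatchingPennies.

Theorem theorem8 (R : realType) (m n : nat) (hm : (0 < m)%N) :
  BL_WoLF_learnable (@matching_pennies_with_duds R m n) n%:R.
Proof.
exists (learner (n := n) hm) => D O N.
have -> : n%:R = potential R D [::].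
  rewrite /potential candidates_history //.
  have -> : revealed (history (matching_pennies_with_duds R D) [::]) = set0.
    by apply/setP => a; rewrite !inE.
  by rewrite setC0 cardsT card_ord natrD addrC addKr.
apply: expected_loss_potential => p.
- exact: potential_ge0.
- exact: potential_step.
Qed.
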